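(* Let $n>1$ agents $\mathcal N=\{1,\dots,n\}$ communicate over a time-varying directed graph $\mathbb N(t)=(\mathcal N,\mathcal E(t))$, $t=1,2,\dots$, where $(i,j)\in\mathcal E(t)$ means agent $i$ can send information to agent $j$ at time $t$. Let $o_i(t)$ be the out-degree of $i$ in $\mathbb N(t)$ and $\mathcal N_i^{\mathrm{in}}(t)=\{j:(j,i)\in\mathcal E(t)\}$ its set of in-neighbors. For each agent $i$, let $x_i(1),x_i(2),\dots$ be i.i.d. samples of a random variable $X_i$ with $|X_i|\le K$ almost surely; put $\bar x_i=E[X_i]$, $\bar x=\frac1n\sum_i\bar x_i$, and $z_i(t)=\frac1t\sum_{\tau=1}^t x_i(\tau)$. Each agent initializes $y_i(1)=x_i(1)$, $v_i(1)=1$, and for $t=1,2,\dots$ updates $$\mu_i(t+1)=\frac{y_i(t)}{1+o_i(t)}+\sum_{j\in\mathcal N_i^{\mathrm{in}}(t)}\frac{y_j(t)}{1+o_j(t)},\qquad v_i(t+1)=\frac{v_i(t)}{1+o_i(t)}+\sum_{j\in\mathcal N_i^{\mathrm{in}}(t)}\frac{v_j(t)}{1+o_j(t)},$$ $$y_i(t+1)=\mu_i(t+1)+z_i(t+1)-z_i(t).$$ Assume: (i) for every $t$ there is a symmetric stochastic matrix $W(t)$ with positive diagonal entries and $w_{ij}(t)=0$ whenever $i\neq j$ and $(i,j)\notin\mathcal E(t)$; (ii) $\{\mathbb N(t)\}$ is repeatedly jointly strongly connected: there is a positive integer $r$ such that for each $k\ge0$ the union of $\mathbb N(rk+1),\dots,\mathbb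 N(r(k+1))$ is strongly connected. Then $\lim_{t\to\infty}\mu_i(t)/v_i(t)=\bar x$ for all $i$ almost surely. Moreover, the sequences $\{\mu_i(t)/v_i(t)\}$ reach consensus at rate $O(1/t)$ with high probability: there is a constant $C$ such that, with probability tending to $1$ as $t\to\infty$, $\max_i\mu_i(t)/v_i(t)-\min_j\mu_j(t)/v_j(t)\le C/t$.
   Context: The union of directed graphs on the same vertex set has as edge set the union of their edge sets; a directed graph is strongly connected if there is a directed path between each ordered pair of distinct vertices. ''With high probability'' means with probability tending to $1$ as $t\to\infty$. Each agent sends $y_i(t)/(1+o_i(t))$ and $v_i(t)/(1+o_i(t))$ to its out-neighbors. *)

(* Defs.v *)
From HB Require Import structures.
From mathcomp Require Import all_boot all_order all_algebra.
From mathcomp Require Import all_classical all_reals all_analysis.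
Set Implicit Arguments. Unset Strict Implicit. Unset Printing Implicit Defensive.
Import Order.TTheory GRing.Theory Num.Theory.
Local Open Scope ring_scope.
Local Open Scope classical_set_scope.

Section PushSum.
Variables (R : realType) (n : nat).

(* E t : directed edge relation of the graph N(t) on 'I_n;
   E t i j means agent i can send to agent j at time t.
   Self loops are ignored: neighbours are always distinct from the agent. *)
Definition outdeg (E : nat -> rel 'I_n) (t : nat) (i : 'I_n) : nat :=
  #|[set j | (j != i) && E t i j]|.

Definition push (E : nat -> rel 'I_n) (t : nat) (a : 'I_n -> R) (i : 'I_n) : R :=
  a i / (1 + (outdeg E t i)%:R)
  + \sum_(j | (j != i) && E t j i) a j / (1 + (outdeg E t j)%:R).

Definition zavg (xs : 'I_n -> nat -> R) (i : 'I_n) (t : nat) : R :=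
  (\sum_(1 <= tau < t.+1) xs i tau) / t%:R.

(* yv k = (y(k+1), v(k+1)) *)
Fixpoint yv (E : nat -> rel 'I_n) (xs : 'I_n -> nat -> R) (k : nat)
  : ('I_n -> R) * ('I_n -> R) :=
  match k with
  | 0 => (fun i => xs i 1%N, fun _ => 1)
  | k'.+1 =>
      let (y, v) := yv E xs k' in
      let t := k'.+1 in
      (fun i => push E t y i + zavg xs i t.+1 - zavg xs i t, push E t v)
  end.

Definition yseq E xs (t : nat) : 'I_n -> R := (yv E xs t.-1).1.
Definition vseq E xs (t : nat) : 'I_n -> R := (yv E xs t.-1).2.
(* mu_i(t) for t >= 2 : mu_i(t) = push at time t-1 of y(t-1) *)
Definition museq E xs (t : nat) : 'I_n -> R := push E t.-1 (yseq E xs t.-1).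
Definition ps_ratio E xs (t : nat) (i : 'I_n) : R := museq E xs t i / vseq E xs t i.

Definition sym_stoch_compatible (E : nat -> rel 'I_n) : Prop :=
  forall t : nat, (1 <= t)%N -> exists W : 'M[R]_n,
    [/\ W^T = W,
        forall i j, 0 <= W i j,
        forall i, \sum_j W i j = 1,
        forall i, 0 < W i i
      & forall i j, i != j -> ~~ E t i j -> W i j = 0].
End PushSum.

Definition strongly_connected (n : nat) (e : rel 'I_n) : Prop :=
  forall i j : 'I_n, i != j -> connect e i j.

Definition graph_union (n : nat) (E : nat -> rel 'I_n) (a b : nat) : rel 'I_n :=
  fun i j => [exists t : 'I_b.+1, (a <= t)%N && E t i j].

Definition repeatedly_jointly_sc (n : nat) (E : nat -> rel 'I_n) : Prop :=
  exists r : nat, (0 < r)%N /\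
    forall k : nat, strongly_connected (graph_union E (r * k).+1 (r * k.+1)).

Definition mutually_independent d (T : measurableType d) (R : realType)
  (P : probability T R) (X : nat -> {RV P >-> R}) : Prop :=
  forall (F : seq nat) (B : nat -> set R), uniq F ->
    (forall t, t \in F -> (1 <= t)%N) ->
    (forall t, t \in F -> measurable (B t)) ->
    P (\bigcap_(t in [set t | t \in F]) (X t @^-1` B t)) =
    (\prod_(t <- F) P (X t @^-1` B t))%E.

Definition identically_distributed d (T : measurableType d) (R : realType)
  (P : probability T R) (X : nat -> {RV P >-> R}) : Prop :=
  forall t, (1 <= t)%N -> forall B : set R, measurable B ->
    P (X t @^-1` B) = P (X 1%N @^-1` B).

(* Main.v *)
Require Import Defs.
From HB Require Import structures.
From mathcomp Require Import all_boot all_order all_algebra.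
From mathcomp Require Import all_classical all_reals all_analysis.
From mathcomp Require Import measurable_realfun ring lra zify.
Import Order.TTheory GRing.Theory Num.Theory numFieldNormedType.Exports.
Local Open Scope ring_scope.
Local Open Scope classical_set_scope.

(* With [u_i = y_i / v_i], push-sum becomes [u(t+1) = B(t) u(t) + err(t)] with
   [B(t)] row-stochastic and [|err(t)| = O(1/t)], because [v] is bounded below
   and [z(t+1) - z(t) = O(1/t)].  Joint strong connectivity makes the spread of
   [u] contract by a fixed factor over windows of length [r * n], so the spread
   is [O(1/t)], deterministically on the almost sure event that all samples are
   bounded by [K].  Both [mu_i(t+1) / v_i(t+1)] and the average
   [(sum_i z_i(t)) / n = (sum_i y_i(t)) / (sum_i v_i(t))] are convex
   combinations of the [u_i(t)], and the latter tends to [xbar] by the strong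
   law of large numbers.  For bounded samples the strong law follows from the
   variance bound [K^2 / N], which is summable along [N = k^2], and from
   interpolation between consecutive squares. *)

Set Implicit Arguments.
Unset Strict Implicit.

(** * Perturbed averaging on jointly connected graphs *)

Lemma connect_exits (T : finType) (e : rel T) (S : {set T}) (a b : T) :
  connect e a b -> a \in S -> b \notin S ->
  exists c d, [/\ c \in S, d \notin S & e c d].
Proof.
case/connectP=> p; elim: p a => [|d p IH] a /= => [_ ->|/andP[ead pp] bl] aS bS.
  by rewrite aS in bS.
have [dS|dS] := boolP (d \in S); first exact: IH pp bl dS bS.
by exists a, d.
Qed.

(** Kept abstract in [f], which is later the weights [v] and also the gap between [u] and its upper
    bound. Every window reaches a new node, at the price of a factor [b] per time step, so [n]
    windows reach all of them. *)
Lemma mass_propagation (R : realFieldType) (n : nat) (E : nat -> rel 'I_n)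
  (r k : nat) (f : nat -> 'I_n -> R) (b c : R) (j : 'I_n) :
  0 <= b ->
  (forall q, strongly_connected (graph_union E (r * q).+1 (r * q.+1))) ->
  (forall t (i' i : 'I_n), (r * k < t)%N -> (i == i') || E t i' i ->
     b * f t i' <= f t.+1 i) ->
  c <= f (r * k).+1 j ->
  forall i, b ^+ (r * n) * c <= f (r * (k + n)).+1 i.
Proof.
move=> b0 sc fE cj.
(* [S] is nondecreasing, and over each window it gains a node until it is full. *)
pose S s := [set i | b ^+ (s - (r * k).+1) * c <= f s i]%SET.
have S_step s i' i : (r * k < s)%N -> i' \in S s -> (i == i') || E s i' i ->
    i \in S s.+1.
  rewrite !inE => ks i'S e; apply: le_trans (fE _ _ _ ks e).
  by rewrite subSn// exprS -mulrA ler_wpM2l.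
have S_mono s m : (r * k < s)%N -> S s \subset S (s + m)%N.
  move=> ks; elim: m => [|m IH]; first by rewrite addn0.
  apply: (fintype.subset_trans IH); apply/fintype.subsetP => i iS.
  rewrite addnS; apply: (S_step _ _ _ _ iS); last by rewrite eqxx.
  by rewrite ltn_addr.
have S_grow m : (minn n m.+1 <= #|S (r * (k + m)).+1|)%N.
  elim: m => [|m IH].
    rewrite addn0 (leq_trans (geq_minr _ _))//; apply/card_gt0P; exists j.
    by rewrite inE subnn expr0 mul1r.
  have km : (r * k < (r * (k + m)).+1)%N by rewrite ltnS leq_mul2l leq_addr orbT.
  have sub : S (r * (k + m)).+1 \subset S (r * (k + m.+1)).+1.
    have -> : (r * (k + m.+1)).+1 = ((r * (k + m)).+1 + r)%N.
      by rewrite addnS mulnS addnC addSn.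
    exact: S_mono.
  have [lt|ge] := ltnP (minn n m.+1) #|S (r * (k + m)).+1|.
    apply: leq_trans (subset_leq_card sub); apply: leq_trans lt.
    by move: IH lt; lia.
  have cardS : #|S (r * (k + m)).+1| = minn n m.+1 by apply/eqP; rewrite eqn_leq ge.
  have [full|nfull] := eqVneq (S (r * (k + m)).+1) [set: 'I_n]%SET.
    have := subset_leq_card sub; rewrite full cardsT card_ord => /(leq_trans _); apply.
    exact: geq_minl.
  have [a aS] : exists a, a \in S (r * (k + m)).+1.
    apply/card_gt0P; rewrite cardS leq_min andbT.
    by rewrite (leq_ltn_trans (leq0n j) (ltn_ord j)).
  have [z zS] : exists z, z \notin S (r * (k + m)).+1.
    by apply/existsP; rewrite -negb_forall; apply: contra nfull => /forallP H;
       apply/eqP/finset.setP => i; rewrite H inE.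
  have az : a != z by apply: contra zS => /eqP <-.
  (* A path in the union graph must leave the set along some edge from [c'] to [d], live at a time
     [s] of the window. By monotonicity [c'] is still in the set at [s], so [d] enters at [s.+1] and
     stays until the window closes. *)
  have [c' [d [c'S dS]]] := connect_exits (sc (k + m)%N a z az) aS zS.
  case/existsP => s /andP[s1 esd].
  have dS' : d \in S (r * (k + m.+1)).+1.
    have s2 : (s <= r * (k + m).+1)%N by rewrite -ltnS.
    have c's : c' \in S s.
      by rewrite -(subnKC s1); apply: (fintype.subsetP (S_mono _ _ _)) c'S.
    have ds : d \in S s.+1.
      by apply: (S_step _ _ _ _ c's); rewrite ?esd ?orbT// (leq_trans km).
    rewrite addnS -(subnKC s2) -addSn.
    by apply: (fintype.subsetP (S_mono _ _ _)) ds; rewrite ltnW// ltnS (leq_trans km).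
  suff : (#|S (r * (k + m)).+1| < #|S (r * (k + m.+1)).+1|)%N.
    by rewrite cardS; lia.
  rewrite -add1n -[1%N]/(true : nat) -dS -cardsU1; apply: subset_leq_card.
  by rewrite finset.subUset finset.sub1set dS' sub.
move=> i; have := S_grow n; rewrite (minn_idPl (leqnSn n)) => Sn.
have : i \in S (r * (k + n)).+1.
  have /eqP -> : S (r * (k + n)).+1 == [set: 'I_n]%SET.
    by rewrite finset.eqEcard finset.subsetT cardsT card_ord.
  exact: finset.in_setT.
by rewrite inE mulnDr subSS addKn.
Qed.

(** The matrix is existentially quantified at each time because for push-sum it depends on the
    current weights [v]. Entry [B i j] weighs what [i] receives from [j], hence the edge
    [E t j i]. *)
Definition perturbed_averaging (R : realFieldType) (n : nat) (E : nat -> rel 'I_n)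
    (b : R) (e : nat -> R) (u : nat -> 'I_n -> R) : Prop :=
  forall t, (0 < t)%N -> exists B : 'M[R]_n,
    [/\ forall i j, 0 <= B i j,
        forall i, \sum_j B i j = 1,
        forall i j, (i == j) || E t j i -> b <= B i j
      & forall i, `|u t.+1 i - \sum_j B i j * u t j| <= e t].

Section PerturbedAveraging.
Context {R : realFieldType} {n : nat} {E : nat -> rel 'I_n}.
Implicit Types (b : R) (e : nat -> R) (u : nat -> 'I_n -> R).

Lemma perturbed_averagingN b e u :
  perturbed_averaging E b e u -> perturbed_averaging E b e (fun t i => - u t i).
Proof.
move=> pa t /pa[B [B0 B1 Bb uB]]; exists B; split=> // i.
under eq_bigr do rewrite mulrN.
by rewrite sumrN -opprD normrN uB.
Qed.

(** The gaps [M - u t k] are nonnegative, so their average dominates its single term at [j], whose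
    weight is at least [b]. *)
Lemma perturbed_averaging_step b e u t M : perturbed_averaging E b e u ->
  (0 < t)%N -> (forall i, u t i <= M) ->
  forall i j, (i == j) || E t j i -> b * (M - u t j) <= M + e t - u t.+1 i.
Proof.
move=> pa t0 uM i j eij; have [B [B0 B1 Bb uB]] := pa t t0.
have : b * (M - u t j) <= \sum_k B i k * (M - u t k).
  rewrite (bigD1 j)//= -[leLHS]addr0 lerD//.
    by rewrite ler_wpM2r ?subr_ge0// Bb.
  by apply: sumr_ge0 => k _; rewrite mulr_ge0// subr_ge0.
under eq_bigr do rewrite mulrBr.
rewrite sumrB -mulr_suml B1 mul1r.
by have := uB i; rewrite ler_norml; lra.
Qed.

Lemma perturbed_averaging_ub b e u s m M : perturbed_averaging E b e u ->
  0 <= b -> (0 < s)%N -> (forall i, u s i <= M) ->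
  forall i, u (s + m)%N i <= M + \sum_(s <= k < s + m) e k.
Proof.
move=> pa b0 s0 uM; elim: m => [|m IH] i.
  by rewrite addn0 big_geq// addr0.
have sm : (0 < s + m)%N by rewrite ltn_addr.
have /(_ i i) := perturbed_averaging_step pa sm IH.
rewrite eqxx addnS big_nat_recr ?leq_addr//= => /(_ isT).
have : 0 <= b * (M + \sum_(s <= k < s + m) e k - u (s + m)%N i).
  by rewrite mulr_ge0// subr_ge0.
lra.
Qed.

Lemma perturbed_averaging_spread b e u s m D : perturbed_averaging E b e u ->
  0 <= b -> (0 < s)%N -> (forall i j, u s i - u s j <= D) ->
  forall i j, u (s + m)%N i - u (s + m)%N j <= D + 2 * \sum_(s <= k < s + m) e k.
Proof.
move=> pa b0 s0 uD i j.
pose M := u s [arg max_(k > i) u s k]%O.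
pose M' := u s [arg min_(k < i) u s k]%O.
have uM k : u s k <= M by rewrite /M; case: arg_maxP => // l _; exact.
have uM' k : - u s k <= - M' by rewrite lerN2 /M'; case: arg_minP => // l _; exact.
have := perturbed_averaging_ub m pa b0 s0 uM i.
have := perturbed_averaging_ub m (perturbed_averagingN pa) b0 s0 uM' j.
have : M - M' <= D by exact: uD.
lra.
Qed.

(** The gap at the minimizing node equals [M - M']; after [n] windows a fraction [b ^+ (r * n)] of
    it separates every node from the drifting maximum. The minimum is only allowed to drift, and the
    two drifts give the factor [2]. *)
Lemma perturbed_averaging_contraction b e u r k D :
  perturbed_averaging E b e u -> 0 <= b <= 1 ->
  (forall q, strongly_connected (graph_union E (r * q).+1 (r * q.+1))) ->
  (forall i j, u (r * k).+1 i - u (r * k).+1 j <= D) ->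
  forall i j, u (r * (k + n)).+1 i - u (r * (k + n)).+1 j <=
    (1 - b ^+ (r * n)) * D
    + 2 * \sum_((r * k).+1 <= s < (r * (k + n)).+1) e s.
Proof.
move=> pa /andP[b0 b1] sc uD i j.
set s := (r * k).+1; have s0 : (0 < s)%N by [].
have sE : (r * (k + n)).+1 = (s + r * n)%N by rewrite mulnDr -addSn.
pose M := u s [arg max_(l > i) u s l]%O.
pose M' := u s [arg min_(l < i) u s l]%O.
have uM l : u s l <= M by rewrite /M; case: arg_maxP => // l' _; exact.
have uM' l : - u s l <= - M' by rewrite lerN2 /M'; case: arg_minP => // l' _; exact.
have MD : M - M' <= D by exact: uD.
have low := perturbed_averaging_ub (r * n) (perturbed_averagingN pa) b0 s0 uM' j.
(* The gap [f] to the drifting upper bound [M + \sum e] spreads like a mass. *)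
pose f t l := M + \sum_(s <= q < t) e q - u t l.
have fE t (i1 i2 : 'I_n) : (r * k < t)%N -> (i2 == i1) || E t i1 i2 ->
    b * f t i1 <= f t.+1 i2.
  move=> st; rewrite /f big_nat_recr//= [M + (_ + _)]addrA.
  apply: (perturbed_averaging_step pa) => //; first exact: leq_ltn_trans st.
  by move=> l; rewrite -(subnKC st); exact: (perturbed_averaging_ub _ pa).
have fM : M - M' <= f s [arg min_(l < i) u s l]%O.
  by rewrite /f big_geq// addr0.
have := mass_propagation b0 sc fE fM i.
rewrite /f sE -/s.
have : (1 - b ^+ (r * n)) * (M - M') <= (1 - b ^+ (r * n)) * D.
  by rewrite ler_wpM2l// subr_ge0 exprn_ile1.
move: low; rewrite mulrBl mul1r.
lra.
Qed.

End PerturbedAveraging.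

(* The recursion [d q.+1 = (1 - a) * d q + g / q.+1] is dominated by
   [c / (q + 2 / a)]. *)
Lemma inverse_linear_supersolution (R : realFieldType) (a g D : R) :
  0 < a <= 1 -> 0 <= g -> exists (C : R) (d : nat -> R),
  [/\ D <= d 0%N, forall q, (1 - a) * d q + g / q.+1%:R <= d q.+1
    & forall q, d q <= C / q.+1%:R].
Proof.
move=> /andP[a0 a1] g0.
(* With this [h], [a * X >= 2] for [X = q + h], so half of the contraction gain pays for the decay
   from [C / X] to [C / (X + 1)]. The other half pays for the forcing, since the term [g * h ^+ 2]
   of [C] gives [2 * g * h <= a * C]; the term [|D| * h] covers the start. *)
pose h := 2 / a; have ah : a * h = 2 by rewrite /h mulrCA divff ?mulr1// gt_eqF.
have h2 : 2 <= h by rewrite /h ler_pdivlMr// ler_piMr.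
pose C := `|D| * h + g * h ^+ 2.
have Ch : g * h ^+ 2 <= C by rewrite lerDr mulr_ge0//; lra.
have C0 : 0 <= C by apply: le_trans Ch; rewrite mulr_ge0// sqr_ge0.
exists C, (fun q => C / (q%:R + h)); split=> [|q|q].
- rewrite add0r ler_pdivlMr; last lra.
  have : D * h <= `|D| * h by rewrite ler_wpM2r ?ler_norm//; lra.
  have gh : 0 <= g * h ^+ 2 by rewrite mulr_ge0// sqr_ge0.
  by rewrite /C; lra.
- have q0 : 0 <= q%:R :> R by [].
  set X := q%:R + h.
  have X0 : 0 < X by rewrite /X; lra.
  have gX : g / q.+1%:R <= g * h / X.
    rewrite ler_pdivrMr// mulrAC ler_pdivlMr// -mulrA ler_wpM2l//.
    by rewrite /X -natr1 mulrDr mulr1 lerD2r ler_peMl//; lra.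
  have -> : q.+1%:R + h = X + 1 by rewrite /X -natr1; ring.
  have : ((1 - a) * C + g * h) / X <= C / (X + 1).
    rewrite ler_pdivrMr// mulrAC ler_pdivlMr; last lra.
    have E1 : 0 <= (a * X - 2) * C.
      by rewrite mulr_ge0// -ah subr_ge0 ler_wpM2l//; rewrite /X; lra.
    have E2 : 0 <= (a * C - 2 * g * h) * (X + 1).
      rewrite mulr_ge0//; last lra.
      rewrite subr_ge0 (le_trans _ (ler_wpM2l _ Ch))//; last lra.
      have -> : a * (g * h ^+ 2) = a * h * g * h by ring.
      by rewrite ah.
    have E3 : 0 <= a * C by rewrite mulr_ge0// ltW.
    nra.
  by rewrite mulrDl -mulrA; apply: le_trans; rewrite lerD2l.
- have q0 : 0 <= q%:R :> R by [].
  have qh : q.+1%:R <= q%:R + h by rewrite -natr1; lra.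
  by rewrite ler_wpM2l// lef_pV2// posrE ?ltr0n//; lra.
Qed.

(** [C] is chosen before [u], so one constant serves every sample path. The spread is followed at
    the times [L * q + 1], where the contraction gives the recursion of
    [inverse_linear_supersolution]. *)
Lemma perturbed_averaging_rate (R : realFieldType) (n : nat)
    (E : nat -> rel 'I_n) (r : nat) (b g D : R) :
  (0 < r)%N -> (0 < n)%N -> 0 < b <= 1 -> 0 <= g ->
  (forall q, strongly_connected (graph_union E (r * q).+1 (r * q.+1))) ->
  exists C : R, forall u,
    perturbed_averaging E b (fun t => g / t%:R) u ->
    (forall i j, u 1%N i - u 1%N j <= D) ->
    forall t, (0 < t)%N -> forall i j, u t i - u t j <= C / t%:R.
Proof.
move=> r0 n0 /andP[b0 b1] g0 sc; set L := (r * n)%N.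
have L0 : (0 < L)%N by rewrite muln_gt0 r0.
have a01 : 0 < b ^+ L <= 1 by rewrite exprn_gt0// exprn_ile1// ltW.
have Lg0 : 0 <= 2 * L%:R * g by rewrite !mulr_ge0.
have [C [d [Dd0 dS dC]]] := inverse_linear_supersolution D a01 Lg0.
(* Each [s] in block [q] is at least [q + 1]. Taking any [m <= L] covers both full blocks and the
   final partial one. *)
have sum_le q m : (m <= L)%N ->
    2 * \sum_((L * q).+1 <= s < (L * q).+1 + m) g / s%:R <= 2 * L%:R * g / q.+1%:R.
  move=> mL; rewrite -!mulrA ler_wpM2l//.
  apply: (@le_trans _ _ (\sum_((L * q).+1 <= s < (L * q).+1 + m) g / q.+1%:R)).
    rewrite big_nat_cond [leRHS]big_nat_cond; apply: ler_sum => s /andP[/andP[qs _] _].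
    rewrite ler_wpM2l// lef_pV2 ?posrE ?ltr0n//; last exact: leq_trans qs.
    by rewrite ler_nat (leq_trans _ qs)// ltnS leq_pmull.
  rewrite sumr_const_nat addKn -[_ *+ m]mulr_natl; apply: ler_wpM2r.
    by rewrite divr_ge0.
  by rewrite ler_nat.
(* The spread at the last block start plus the drift since then is at most
   [(C + 2 * L * g) / (q + 1)]; the last factor [L] comes from [t <= L * (q + 1)]. *)
exists ((C + 2 * L%:R * g) * L%:R) => u pa u1 t t0 i j.
have ud q : forall i j, u (L * q).+1 i - u (L * q).+1 j <= d q.
  elim: q => [|q IH] k l; first by rewrite muln0; exact: le_trans Dd0.
  apply: le_trans (dS q); apply: le_trans (lerD (lexx _) (sum_le q L (leqnn _))).
  have E1 : (L * q.+1)%N = (r * (n * q + n))%N by rewrite -mulnSr mulnA.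
  have E2 : (L * q)%N = (r * (n * q))%N by rewrite mulnA.
  have -> : ((L * q).+1 + L)%N = (r * (n * q + n)).+1.
    by rewrite -E1 mulnS addSn addnC.
  rewrite E1 E2; apply: (perturbed_averaging_contraction pa) => //.
    by rewrite (ltW b0).
  by rewrite -E2.
set q := (t.-1 %/ L)%N; set m := (t.-1 %% L)%N.
have tE : t = ((L * q).+1 + m)%N.
  by rewrite addSn mulnC -divn_eq prednK.
have mL : (m <= L)%N by rewrite ltnW// ltn_pmod.
have := perturbed_averaging_spread m pa (ltW b0) (ltn0Sn _) (ud q) i j.
rewrite -tE => /le_trans; apply.
have := sum_le q m mL; rewrite -tE => /(lerD (dC q))/le_trans; apply.
rewrite -mulrDl -[leRHS]mulrA.
have CL : 0 <= C + 2 * L%:R * g.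
  rewrite addr_ge0//; have := le_trans (ud 0%N i i) (dC 0%N).
  by rewrite subrr divr1.
rewrite ler_wpM2l// ler_pdivlMr ?ltr0n// ler_pdivrMl ?ltr0n//.
rewrite -natrM ler_nat.
by rewrite tE; nia.
Qed.

(** * Push-sum *)

Lemma convex_comb_spread (R : realFieldType) (I : finType) (p q u : I -> R) (D : R) :
  (forall i, 0 <= p i) -> (forall i, 0 <= q i) ->
  \sum_i p i = 1 -> \sum_i q i = 1 -> (forall i j, u i - u j <= D) ->
  \sum_i p i * u i - \sum_i q i * u i <= D.
Proof.
move=> p0 q0 p1 q1 uD.
have pu j : \sum_i p i * u i - u j <= D.
  rewrite -[u j]mul1r -p1 mulr_suml -sumrB -[leRHS]mul1r -p1 mulr_suml.
  by apply: ler_sum => i _; rewrite -mulrBr ler_wpM2l.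
rewrite -[X in X - _]mul1r -q1 mulr_suml -sumrB -[leRHS]mul1r -q1 mulr_suml.
by apply: ler_sum => i _; rewrite -mulrBr ler_wpM2l.
Qed.

Section PushSumFacts.
Variables (R : realType) (n : nat) (E : nat -> rel 'I_n).
Implicit Types (t : nat) (i j : 'I_n) (xs : 'I_n -> nat -> R).

(** The matrix of [push], self-loops included. Its columns sum to one, so pushing preserves totals;
    its rows need not. *)
Let pw t i j : R := ((i == j) || E t j i)%:R / (1 + (outdeg E t j)%:R).

Lemma push_weightsE t (a : 'I_n -> R) i : push E t a i = \sum_j pw t i j * a j.
Proof.
rewrite (bigD1 i)//= /push /pw eqxx mul1r mulrC; congr (_ + _).
rewrite big_mkcondr; apply: eq_bigr => j ji.
by rewrite eq_sym (negbTE ji)/=; case: (E t j i); rewrite ?mul0r// mul1r mulrC.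
Qed.

Lemma pw_ge0 t i j : 0 <= pw t i j.
Proof. by rewrite divr_ge0. Qed.

Lemma pw_sum t j : \sum_i pw t i j = 1.
Proof.
rewrite -mulr_suml (bigD1 j)//= eqxx/=.
have -> : \sum_(i | i != j) ((i == j) || E t j i)%:R = (outdeg E t j)%:R :> R.
  rewrite /outdeg -sum1_card natr_sum.
  rewrite [RHS](eq_bigl (fun i => (i != j) && E t j i)); last first.
    by move=> i; apply/idP/idP => [/set_mem|/mem_set].
  rewrite [RHS]big_mkcondr; apply: eq_bigr => i ij.
  by rewrite (negbTE ij)/=; case: (E t j i).
by rewrite divff// nat1r pnatr_eq0.
Qed.

(** An agent has at most [n - 1] out-neighbours. *)
Lemma pw_edge t i j : (i == j) || E t j i -> n%:R^-1 <= pw t i j.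
Proof.
move=> e; rewrite /pw e mul1r nat1r lef_pV2 ?posrE ?ltr0n//; last first.
  exact: leq_ltn_trans (ltn_ord i).
rewrite ler_nat /outdeg.
apply: (@leq_trans #|~: [set j]%SET|.+1); last first.
  by rewrite cardsC1 card_ord prednK// (leq_ltn_trans _ (ltn_ord i)).
rewrite ltnS; apply: subset_leq_card; apply/fintype.subsetP => k.
by move=> /set_mem/andP[kj _]; rewrite !inE.
Qed.

Lemma vseqS xs t : (0 < t)%N -> vseq E xs t.+1 = push E t (vseq E xs t).
Proof. by case: t => // t _; rewrite /vseq /=; case: (yv E xs t). Qed.

Lemma yseqS xs t i : (0 < t)%N ->
  yseq E xs t.+1 i = push E t (yseq E xs t) i + zavg xs i t.+1 - zavg xs i t.
Proof. by case: t => // t _; rewrite /yseq /=; case: (yv E xs t). Qed.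

Lemma push_sum_mass t (a : 'I_n -> R) : \sum_i push E t a i = \sum_i a i.
Proof.
under eq_bigr do rewrite push_weightsE.
rewrite exchange_big/=; apply: eq_bigr => j _.
by rewrite -mulr_suml pw_sum mul1r.
Qed.

Lemma vseq_sum xs t : (0 < t)%N -> \sum_i vseq E xs t i = n%:R.
Proof.
elim: t => // -[_ _|t IH _]; first by rewrite sumr_const card_ord.
by rewrite vseqS// push_sum_mass IH.
Qed.

(** Pushing preserves the total, and the added increments of [z] telescope from [y(1) = z(1)]. *)
Lemma yseq_sum xs t : (0 < t)%N -> \sum_i yseq E xs t i = \sum_i zavg xs i t.
Proof.
elim: t => // -[_ _|t IH _].
  by apply: eq_bigr => i _; rewrite /zavg big_nat1 divr1.
under eq_bigr do rewrite yseqS//.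
by rewrite sumrB big_split/= push_sum_mass IH// addrAC subrr add0r.
Qed.

Lemma vseq_ge0 xs t i : 0 <= vseq E xs t i.
Proof.
case: t => [|t]; first exact: ler01.
elim: t i => [|t IH] i; first exact: ler01.
rewrite vseqS// push_weightsE; apply: sumr_ge0 => j _.
by rewrite mulr_ge0// pw_ge0.
Qed.

Lemma vseq_le xs t i : (0 < t)%N -> vseq E xs t i <= n%:R.
Proof.
move=> t0; rewrite -(vseq_sum xs t0) (bigD1 i)//= lerDl.
by apply: sumr_ge0 => j _; rewrite vseq_ge0.
Qed.

Lemma vseq_edge xs t j i : (0 < t)%N -> (i == j) || E t j i ->
  n%:R^-1 * vseq E xs t j <= vseq E xs t.+1 i.
Proof.
move=> t0 e; rewrite vseqS// push_weightsE (bigD1 j)//= -[leLHS]addr0 lerD//.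
  by rewrite ler_wpM2r ?vseq_ge0// pw_edge.
by apply: sumr_ge0 => k _; rewrite mulr_ge0 ?pw_ge0 ?vseq_ge0.
Qed.

(** The weights total [n], so some node has weight at least [1] at each block start; propagation
    over the block costs [b ^+ L], and reaching a time inside the next block costs at most another
    [b ^+ L]. *)
Lemma vseq_lb (r : nat) : (0 < r)%N -> (0 < n)%N ->
  (forall q, strongly_connected (graph_union E (r * q).+1 (r * q.+1))) ->
  exists2 c : R, 0 < c & forall xs t i, (0 < t)%N -> c <= vseq E xs t i.
Proof.
move=> r0 n0 sc; set L := (r * n)%N.
have L0 : (0 < L)%N by rewrite muln_gt0 r0.
set b : R := n%:R^-1; have b0 : 0 < b by rewrite invr_gt0 ltr0n.
have b1 : b <= 1 by rewrite invf_le1 ?ltr0n// ler1n.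
have bX m : b ^+ m <= 1 by rewrite exprn_ile1// ltW.
exists (b ^+ L * b ^+ L) => [|xs t i t0]; first by rewrite mulr_gt0// exprn_gt0.
have block q j : b ^+ L <= vseq E xs (L * q).+1 j.
  case: q => [|q]; first by rewrite muln0; exact: bX.
  have [k k1] : exists k, 1 <= vseq E xs (L * q).+1 k.
    apply/existsP; rewrite -[X in is_true X]negbK negb_exists; apply/negP => /forallP H.
    suff : \sum_k vseq E xs (L * q).+1 k < \sum_(k < n) 1.
      by rewrite vseq_sum// sumr_const card_ord ltxx.
    apply: ltr_sum => [|k _]; last by rewrite ltNge; exact: H.
    by apply/hasP; exists j; rewrite ?mem_index_enum.
  have E1 : (L * q.+1)%N = (r * (n * q + n))%N by rewrite -mulnSr mulnA.
  rewrite -[leLHS]mulr1 E1; apply: (mass_propagation (ltW b0) sc _ (j := k)).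
    by move=> s i1 i2 qs; apply: vseq_edge; exact: leq_ltn_trans qs.
  by rewrite mulnA.
have mono s m j : (0 < s)%N -> b ^+ m * vseq E xs s j <= vseq E xs (s + m)%N j.
  move=> s0; elim: m => [|m IH]; first by rewrite addn0 expr0 mul1r.
  rewrite exprS -mulrA addnS (le_trans (ler_wpM2l (ltW b0) IH))//.
  by apply: vseq_edge; rewrite ?eqxx// ltn_addr.
have -> : t = ((L * (t.-1 %/ L)).+1 + t.-1 %% L)%N.
  by rewrite addSn mulnC -divn_eq prednK.
apply: le_trans (mono _ _ _ (ltn0Sn _)).
apply: ler_pM; rewrite ?exprn_ge0 ?(ltW b0)//.
by rewrite ler_wiXn2l ?(ltW b0)// ltnW// ltn_pmod.
Qed.

(** The increment is [(x(t+1) - z(t)) / (t+1)], a difference of two numbers bounded by [K]. *)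
Lemma zavg_increment xs (K : R) i t :
  (forall s, (0 < s)%N -> `|xs i s| <= K) -> (0 < t)%N ->
  `|zavg xs i t.+1 - zavg xs i t| <= 2 * K / t%:R.
Proof.
move=> xK t0.
have tp : 0 < t%:R :> R by rewrite ltr0n.
have K0 : 0 <= K by apply: le_trans (xK 1%N isT).
have SK : `|\sum_(1 <= s < t.+1) xs i s| <= t%:R * K.
  apply: le_trans (ler_norm_sum _ _ _) _.
  have -> : t%:R * K = \sum_(1 <= s < t.+1) K.
    by rewrite sumr_const_nat subSS subn0 mulr_natl.
  rewrite big_nat_cond [leRHS]big_nat_cond.
  by apply: ler_sum => s /andP[/andP[s0 _] _]; exact: xK.
rewrite /zavg big_nat_recr//=.
set S := \sum_(_ <= _ < _) _ in SK *.
have -> : (S + xs i t.+1) / t.+1%:R - S / t%:R =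
    (t%:R * xs i t.+1 - S) / t.+1%:R / t%:R.
  by rewrite -natr1; field; rewrite natr1 !gt_eqF// ltr0n.
rewrite normrM normfV (gtr0_norm tp) ler_wpM2r ?invr_ge0 ?(ltW tp)//.
rewrite normrM normfV [`|t.+1%:R|]gtr0_norm ?ltr0n// ler_pdivrMr ?ltr0n//.
apply: le_trans (ler_normB _ _) _; rewrite normrM [`|t%:R|]gtr0_norm//.
have := ler_wpM2l (ltW tp) (xK t.+1 isT).
rewrite -natr1; lra.
Qed.

(** Purely deterministic, with [C] uniform over all sample paths bounded by [K]: the first bound
    gives the consensus rate, the second reduces the limit to that of the sample averages. *)
Lemma push_sum_rate (K : R) : (0 < n)%N -> repeatedly_jointly_sc E ->
  exists2 C : R, 0 <= C & forall xs, (forall i s, (0 < s)%N -> `|xs i s| <= K) ->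
  forall t, (0 < t)%N -> forall i,
  (forall j, ps_ratio E xs t.+1 i - ps_ratio E xs t.+1 j <= C / t%:R) /\
  `|ps_ratio E xs t.+1 i - n%:R^-1 * \sum_j zavg xs j t| <= C / t%:R.
Proof.
move=> n0 [r [r0 sc]]; have [c c0 cv] := vseq_lb r0 n0 sc.
have np : 0 < n%:R :> R by rewrite ltr0n.
(* Lower bound for the entries of [B] below: shares are at least [1 / n], weights at least [c], and
   the dividing weight at most [n]. *)
set b : R := n%:R^-1 * c / n%:R.
have b0 : 0 < b by rewrite !mulr_gt0// invr_gt0.
have b1 : b <= 1.
  have cn : c <= n%:R.
    pose i := Ordinal n0; apply: le_trans (cv (fun _ _ => 0) 1%N i isT) _.
    by rewrite ler1n.
  rewrite ler_pdivrMr// mul1r mulrC ler_pdivrMr//.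
  by rewrite (le_trans cn)// ler_peMl ?ler1n// ltW.
(* The increment bound [2 * K / t] is divided by a weight at least [c]. The absolute value is there
   because [0 <= K] is known only once a sample path is given. *)
have g0 : 0 <= 2 * `|K| / c by rewrite divr_ge0 ?(ltW c0)// mulr_ge0.
have b01 : 0 < b <= 1 by rewrite b0.
have [C HC] := perturbed_averaging_rate (2 * K) r0 n0 b01 g0 sc.
exists `|C| => // xs xK t t0.
have K0 : 0 <= K by apply: le_trans (xK (Ordinal n0) 1%N isT).
pose u t i := yseq E xs t i / vseq E xs t i.
have vp s i : (0 < s)%N -> 0 < vseq E xs s i.
  by move=> s0; exact: lt_le_trans (cv xs s i s0).
(* The push matrix conjugated by the weights; [v(s+1) = pw v(s)] makes its rows sum to one. *)
pose B s i j := pw s i j * vseq E xs s j / vseq E xs s.+1 i.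
have B0 s i j : (0 < s)%N -> 0 <= B s i j.
  by move=> s0; rewrite divr_ge0 ?mulr_ge0 ?pw_ge0 ?vseq_ge0.
have B1 s i : (0 < s)%N -> \sum_j B s i j = 1.
  by move=> s0; rewrite -mulr_suml -push_weightsE -vseqS// divff// gt_eqF// vp.
have ratioE s i : (0 < s)%N -> ps_ratio E xs s.+1 i = \sum_j B s i j * u s j.
  move=> s0; rewrite /ps_ratio /museq push_weightsE mulr_suml.
  apply: eq_bigr => j _; rewrite /B /u; field.
  by rewrite !gt_eqF// vp.
have uD : forall i j, u t i - u t j <= C / t%:R.
  apply: HC => // [s s0|i j].
    exists (\matrix_(i, j) B s i j); split=> [i j|i|i j e|i].
    - by rewrite mxE B0.
    - by under eq_bigr do rewrite mxE; exact: B1.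
    - rewrite mxE /b /B ler_pM ?mulr_ge0 ?invr_ge0 ?(ltW np) ?(ltW c0)//.
        by rewrite ler_pM ?invr_ge0 ?(ltW np) ?(ltW c0) ?pw_edge ?cv.
      by rewrite lef_pV2 ?posrE ?vp// vseq_le.
    - under eq_bigr do rewrite mxE.
      rewrite -ratioE// /ps_ratio /museq /u yseqS//= -mulrBl.
      rewrite [X in X / _](_ : _ = zavg xs i s.+1 - zavg xs i s); last by ring.
      rewrite normrM normfV (gtr0_norm (vp _ _ _))//.
      rewrite [leRHS]mulrAC; apply: ler_pM; rewrite ?invr_ge0 ?vseq_ge0//.
        by rewrite (ger0_norm K0); apply: zavg_increment => // m; exact: xK.
      by rewrite lef_pV2 ?posrE ?vp// cv.
  rewrite /u /yseq /vseq /= !divr1.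
  have := xK i 1%N isT; have := xK j 1%N isT; rewrite !ler_norml; lra.
have CC : C / t%:R <= `|C| / t%:R by rewrite ler_wpM2r ?invr_ge0 ?ler_norm.
(* The average of the [z] is a convex combination of the [u] with weights [v / n], so it lies within
   the spread of the ratios, which are convex combinations too. *)
have zE : n%:R^-1 * \sum_j zavg xs j t = \sum_j (vseq E xs t j / n%:R) * u t j.
  rewrite -yseq_sum// mulr_sumr; apply: eq_bigr => j _.
  by rewrite /u mulrAC mulrCA divff ?mulr1 1?mulrC// gt_eqF// vp.
have w0 j : 0 <= vseq E xs t j / n%:R by rewrite divr_ge0 ?vseq_ge0.
have w1 : \sum_j vseq E xs t j / n%:R = 1.
  by rewrite -mulr_suml vseq_sum// divff// gt_eqF.
have B0t i j : 0 <= B t i j by exact: B0.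
move=> i; split=> [j|].
  by apply: le_trans CC; rewrite !ratioE//; apply: convex_comb_spread; rewrite ?B1.
rewrite ler_norml lerNl opprB zE ratioE//.
by rewrite !(le_trans (convex_comb_spread _ _ _ _ uD) CC)// B1.
Qed.

End PushSumFacts.

(** * Strong law of large numbers for bounded samples *)

Section AeBounded.
Context {d : measure_display} {T : measurableType d} {R : realType}
  (P : probability T R).
Implicit Types (f g : T -> R) (K L : R).

Lemma ae_bounded_ge0 f K : {ae P, forall w, `|f w| <= K} -> 0 <= K.
Proof.
move=> fK; have P0 : (0 < P [set: T])%E by rewrite probability_setT.
have [w wK] := @filter_ex _ _ (ae_properfilter_algebraOfSetsType P0) _ fK.
exact: le_trans wK.
Qed.

Lemma integrable_ae_bounded f K : measurable_fun setT f ->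
  {ae P, forall w, `|f w| <= K} -> P.-integrable setT (EFin \o f).
Proof.
move=> mf fK; apply/integrableP; split; first exact/measurable_EFinP.
have K0 := ae_bounded_ge0 fK.
apply: (@le_lt_trans _ _ (K%:E * P setT)%E).
  apply: integral_le_bound => //; first exact/measurable_EFinP.
  by apply: filterS fK => w fwK _; rewrite lee_fin.
by rewrite probability_setT mule1 ltry.
Qed.

Lemma le_Rintegral_ae_bounded f K : measurable_fun setT f ->
  {ae P, forall w, `|f w| <= K} -> \int[P]_w f w <= K.
Proof.
move=> mf fK; have K0 := ae_bounded_ge0 fK.
have fi := integrable_ae_bounded mf fK.
apply: le_trans (ler_norm _) _; apply: le_trans (le_normr_Rintegral _ fi) _ => //.
have fa : (\int[P]_w `|(f w)%:E| <= K%:E)%E.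
  rewrite -[K%:E]mule1 -(@probability_setT _ _ _ P).
  apply: integral_le_bound => //; first exact/measurable_EFinP.
  by apply: filterS fK => w fwK _; rewrite lee_fin.
rewrite -lee_fin /Rintegral fineK//.
rewrite fin_numElt (lt_le_trans (ltNyr 0)) ?integral_ge0//=.
by rewrite (le_lt_trans fa)// ltry.
Qed.

Lemma ae_boundedM f g K L : {ae P, forall w, `|f w| <= K} ->
  {ae P, forall w, `|g w| <= L} -> {ae P, forall w, `|f w * g w| <= K * L}.
Proof.
by move=> fK gL; apply: filterS2 fK gL => w fK gL; rewrite normrM ler_pM.
Qed.

Lemma ae_boundedD f g K L : {ae P, forall w, `|f w| <= K} ->
  {ae P, forall w, `|g w| <= L} -> {ae P, forall w, `|f w + g w| <= K + L}.
Proof.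
move=> fK gL; apply: filterS2 fK gL => w fK gL.
by rewrite (le_trans (ler_normD _ _))// lerD.
Qed.

End AeBounded.

Section Independence.
Context {d : measure_display} {T : measurableType d} {R : realType}
  (P : probability T R).

(** Independence makes the joint law agree with the product of the marginal laws on rectangles,
    hence everywhere; Fubini then factors the integral. Boundedness supplies integrability. *)
Lemma Rintegral_independentM (X Y : {RV P >-> R}) (K : R) :
  {ae P, forall w, `|X w| <= K} -> {ae P, forall w, `|Y w| <= K} ->
  (forall A B : set R, measurable A -> measurable B ->
     P (X @^-1` A `&` Y @^-1` B) = (P (X @^-1` A) * P (Y @^-1` B))%E) ->
  \int[P]_w (X w * Y w) = \int[P]_w X w * \int[P]_w Y w.
Proof.
move=> XK YK XY.
have mXY : measurable_fun [set: T] (fun w => (X w, Y w)).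
  by apply/measurable_fun_pairP.
pose Z : {RV P >-> (R * R)%type} := MeasurableFun.Pack
  (MeasurableFun.Class (isMeasurableFun.Build _ _ _ _ _ mXY)).
pose f (z : R * R) := (z.1 * z.2)%:E.
have mf : measurable_fun setT f.
  by apply/measurable_EFinP; exact: measurable_funM.
have Xi := integrable_ae_bounded (measurable_funPT X) XK.
have Yi := integrable_ae_bounded (measurable_funPT Y) YK.
have XYi : P.-integrable setT (f \o Z).
  apply: (integrable_ae_bounded _ (ae_boundedM XK YK)).
  exact: measurable_funM.
have prodE A : measurable A -> A `<=` setT ->
    (distribution P X \x distribution P Y)%E A = distribution P Z A.
  by move=> mA _; exact: product_measure_unique.
have Zi : (distribution P Z).-integrable setT f.
  exact: integrable_pushforward.
have fi : (distribution P X \x distribution P Y)%E.-integrable setT f.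
  apply/integrableP; split => //; rewrite (eq_measure_integral (distribution P Z))//.
  by case/integrableP: Zi.
have EX : (\int[distribution P X]_x x%:E = (\int[P]_w X w)%:E)%E.
  rewrite integral_distribution// fineK//; exact: integrable_fin_num.
have EY : (\int[distribution P Y]_x x%:E = (\int[P]_w Y w)%:E)%E.
  rewrite integral_distribution// fineK//; exact: integrable_fin_num.
have Yi' : (distribution P Y).-integrable setT EFin.
  exact: integrable_pushforward.
have Xi' : (distribution P X).-integrable setT EFin.
  exact: integrable_pushforward.
have -> : \int[P]_w (X w * Y w) =
    fine (\int[distribution P X]_x \int[distribution P Y]_y (f (x, y))).
  congr fine; rewrite (integral12_prod_meas1 fi).
  rewrite (eq_measure_integral (distribution P Z))//.
  by rewrite integral_distribution.
under eq_integral => x _.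
  rewrite /f/=; under eq_integral do rewrite EFinM.
  rewrite integralZl// EY; over.
by rewrite /= integralZr// EX.
Qed.
End Independence.

Lemma sqrtn_bracket (t : nat) : (0 < t)%N ->
  exists k, (k.+1 ^ 2 <= t < k.+2 ^ 2)%N.
Proof.
elim: t => // -[_ _|t IH _]; first by exists 0%N.
have [k /andP[k1 k2]] := IH isT.
have [lt|ge] := ltnP t.+2 (k.+2 ^ 2); first by exists k; lia.
by exists k.+1; move: k2 ge; rewrite -!mulnn; lia.
Qed.

(** Between consecutive squares the sum moves by [O(k)], negligible against [k^2]. The hypothesis
    concerns squared averages because second moments are what will be summed. *)
Lemma cesaro_square_subsequence (R : realType) (x : nat -> R) (K : R) :
  (forall s, (0 < s)%N -> `|x s| <= K) ->
  (fun k => ((\sum_(1 <= s < (k.+1 ^ 2).+1) x s) / (k.+1 ^ 2)%:R) ^+ 2) @ \oo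
    --> (0 : R) ->
  (fun t => (\sum_(1 <= s < t.+1) x s) / t%:R) @ \oo --> (0 : R).
Proof.
move=> xK; set S := fun t => \sum_(1 <= s < t.+1) x s => cvgS.
have K0 : 0 <= K by apply: le_trans (xK 1%N isT).
have S_diff a b : (a <= b)%N -> `|S b - S a| <= (b - a)%:R * K.
  move=> ab; rewrite /S (@big_cat_nat _ _ _ a.+1 1 b.+1)//= addrAC subrr add0r.
  apply: le_trans (ler_norm_sum _ _ _) _.
  have -> : (b - a)%:R * K = \sum_(a.+1 <= s < b.+1) K.
    by rewrite sumr_const_nat subSS mulr_natl.
  rewrite big_nat_cond [leRHS]big_nat_cond.
  by apply: ler_sum => s /andP[/andP[s0 _] _]; apply: xK; exact: leq_trans s0.
apply/cvgrPdist_lt => e e0.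
have e2 : 0 < e / 2 by lra.
have [N1 _ HN1] : \forall k \near \oo,
    `|0 - (S (k.+1 ^ 2)%N / (k.+1 ^ 2)%:R) ^+ 2| < (e / 2) ^+ 2.
  by move/cvgrPdist_lt : cvgS; apply; rewrite exprn_gt0.
(* Chosen so that [k >= N2] gives [2 * K < e / 2 * (k + 1)], which makes the terms after the last
   square contribute less than [e / 2]. *)
pose N2 := (Num.truncn (4 * K / e)).+1.
exists ((maxn N1 N2).+1 ^ 2)%N => // t /= Nt.
have [k /andP[k1 k2]] : exists k, (k.+1 ^ 2 <= t < k.+2 ^ 2)%N.
  by apply: sqrtn_bracket; apply: leq_trans Nt; rewrite expn_gt0.
have Nk : (maxn N1 N2 <= k)%N.
  suff : ((maxn N1 N2).+1 < k.+2)%N by [].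
  by rewrite -(ltn_exp2r _ _ (isT : 0 < 2)%N) (leq_ltn_trans Nt).
have k0 : 0 < (k.+1 ^ 2)%:R :> R by rewrite ltr0n expn_gt0.
have t0 : 0 < t%:R :> R by rewrite (lt_le_trans k0)// ler_nat.
have A1 : `|S (k.+1 ^ 2)%N| <= e / 2 * (k.+1 ^ 2)%:R.
  have /= := HN1 k (leq_trans (leq_maxl _ _) Nk).
  rewrite sub0r normrN normrX ltr_pXn2r ?nnegrE ?(ltW e2)//.
  by rewrite normrM normfV (gtr0_norm k0) ltr_pdivrMr// => /ltW.
have A2 : 2 * K < e / 2 * k.+1%:R.
  have : 4 * K / e < k.+1%:R.
    rewrite (lt_le_trans (truncnS_gt _))// ler_nat.
    by rewrite ltnW// ltnS (leq_trans _ Nk)// leq_maxr.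
  by rewrite ltr_pdivrMr//; lra.
have A3 : `|S t - S (k.+1 ^ 2)%N| <= (2 * k.+1)%:R * K.
  apply: le_trans (S_diff _ _ k1) _; rewrite ler_wpM2r// ler_nat.
  by move: k2; rewrite -!mulnn; lia.
rewrite sub0r normrN normrM normfV (gtr0_norm t0) ltr_pdivrMr//.
have A4 : (2 * k.+1)%:R * K < e / 2 * (k.+1 ^ 2)%:R.
  rewrite natrM mulrAC natrX expr2 mulrA ltr_pM2r//.
have A5 : e * (k.+1 ^ 2)%:R <= e * t%:R by rewrite ler_wpM2l ?(ltW e0)// ler_nat.
have := ler_normD (S t - S (k.+1 ^ 2)%N) (S (k.+1 ^ 2)%N).
rewrite subrK; lra.
Qed.

(** Telescoping with [1 / (m + 1)^2 <= 1 / m - 1 / (m + 1)]. At [n = 0] the bound reads [2], since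
    [0^-1 = 0], so the step to [n = 1] is separate. *)
Lemma sum_inverse_squares_le (R : realFieldType) n :
  \sum_(0 <= k < n) (k.+1%:R ^+ 2)^-1 <= 2 - n%:R^-1 :> R.
Proof.
elim: n => [|n IH]; first by rewrite big_geq// invr0 subr0.
rewrite big_nat_recr//=.
case: n IH => [|n] IH; first by rewrite big_geq// mulr1n expr1n !invr1; lra.
suff H : (n.+2%:R ^+ 2)^-1 <= n.+1%:R^-1 - n.+2%:R^-1 :> R.
  by apply: le_trans (lerD IH H) _; rewrite addrA subrK.
have n1 : 0 < n.+1%:R :> R by [].
rewrite -[n.+2%:R]natr1; set m := n.+1%:R in n1 *.
have -> : m^-1 - (m + 1)^-1 = (m * (m + 1))^-1.
  by field; rewrite !gt_eqF//; lra.
rewrite lef_pV2 ?posrE ?exprn_gt0 ?mulr_gt0//; nra.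
Qed.

Section StrongLaw.
Context {d : measure_display} {T : measurableType d} {R : realType}
  (P : probability T R).

(** Orthogonality removes the cross terms, so second moments of partial sums grow linearly. Along
    squares the squared averages have summable integrals, hence an almost surely finite sum, and
    their terms tend to [0]. *)
Lemma orthogonal_strong_law (Z : nat -> T -> R) (K : R) :
  (forall t, measurable_fun setT (Z t)) ->
  (forall t, (0 < t)%N -> {ae P, forall w, `|Z t w| <= K}) ->
  (forall s t, (0 < s < t)%N -> \int[P]_w (Z s w * Z t w) = 0) ->
  {ae P, forall w,
    (fun t => (\sum_(1 <= s < t.+1) Z s w) / t%:R) @ \oo --> (0 : R)}.
Proof.
move=> mZ ZK Zorth.
have allK : {ae P, forall w, forall t, (0 < t)%N -> `|Z t w| <= K}.
  apply: ae_foralln => t; have [->|t0] := posnP t; first exact: aeW.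
  by apply: filterS (ZK t t0).
pose S N w := \sum_(1 <= s < N.+1) Z s w.
have mS N : measurable_fun setT (S N) by exact: measurable_sum.
have SS N w : S N.+1 w = S N w + Z N.+1 w by rewrite /S big_nat_recr.
have bS N : {ae P, forall w, `|S N w| <= N%:R * K}.
  apply: filterS allK => w wK; apply: le_trans (ler_norm_sum _ _ _) _.
  have -> : N%:R * K = \sum_(1 <= s < N.+1) K.
    by rewrite sumr_const_nat subSS subn0 mulr_natl.
  rewrite big_nat_cond [leRHS]big_nat_cond.
  by apply: ler_sum => s /andP[/andP[s0 _] _]; exact: wK.
have intM (f g : T -> R) (a b : R) : measurable_fun setT f -> measurable_fun setT g ->
    {ae P, forall w, `|f w| <= a} -> {ae P, forall w, `|g w| <= b} ->
    P.-integrable setT (EFin \o (fun w => f w * g w)).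
  move=> mf mg fa gb; apply: (integrable_ae_bounded _ (ae_boundedM fa gb)).
  exact: measurable_funM.
have orth M N : (M < N)%N -> \int[P]_w (S M w * Z N w) = 0.
  elim: M => [|M IH] MN.
    under eq_Rintegral do rewrite /S big_geq// mul0r.
    by rewrite Rintegral_cst// mul0r.
  under eq_Rintegral do rewrite SS mulrDl.
  rewrite RintegralD//.
  - by rewrite IH ?(ltnW MN)// Zorth// add0r.
  - by apply: intM (bS _) (ZK _ _) => //; exact: leq_trans MN.
  - by apply: intM (ZK _ _) (ZK _ _) => //; exact: leq_trans MN.
have var N : \int[P]_w (S N w * S N w) <= N%:R * (K * K).
  elim: N => [|N IH].
    under eq_Rintegral do rewrite /S big_geq// mul0r.
    by rewrite Rintegral_cst// !mul0r.
  have iSS : P.-integrable setT (EFin \o (fun w => S N w * S N w)).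
    exact: intM (bS N) (bS N).
  have iSZ : P.-integrable setT (EFin \o (fun w => S N w * Z N.+1 w)).
    by apply: intM (bS N) (ZK _ _).
  have iZZ : P.-integrable setT (EFin \o (fun w => Z N.+1 w * Z N.+1 w)).
    by apply: intM (ZK _ _) (ZK _ _).
  have iSZ2 : P.-integrable setT (EFin \o (fun w => S N w * Z N.+1 w * 2)).
    exact: (integrableZr _ 2 iSZ).
  have -> : \int[P]_w (S N.+1 w * S N.+1 w) = \int[P]_w
      (S N w * S N w + (S N w * Z N.+1 w * 2 + Z N.+1 w * Z N.+1 w)).
    by apply: eq_Rintegral => w _; rewrite SS; ring.
  rewrite RintegralD//; last exact: (integrableD _ iSZ2 iZZ).
  rewrite RintegralD// RintegralZr// orth// mul0r add0r -natr1 mulrDl mul1r.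
  rewrite lerD//; apply: le_Rintegral_ae_bounded; first exact: measurable_funM.
  by apply: ae_boundedM; exact: ZK.
pose F k w := (S (k.+1 ^ 2)%N w / (k.+1 ^ 2)%:R) ^+ 2.
have mF k : measurable_fun setT (EFin \o F k).
  by apply/measurable_EFinP; apply: measurable_funX; exact: measurable_funM.
have F0 k w : (0 <= (EFin \o F k) w)%E by rewrite lee_fin sqr_ge0.
have intF k : (\int[P]_w (EFin \o F k) w <= ((K * K) * (k.+1%:R ^+ 2)^-1)%:E)%E.
  have iS : P.-integrable setT (EFin \o (fun w => S (k.+1 ^ 2)%N w * S (k.+1 ^ 2)%N w)).
    exact: intM (bS _) (bS _).
  have FE w : F k w = S (k.+1 ^ 2)%N w * S (k.+1 ^ 2)%N w * ((k.+1 ^ 2)%:R ^- 2).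
    by rewrite /F expr_div_n expr2.
  have iF : P.-integrable setT (EFin \o F k).
    rewrite (funext FE : F k = _).
    exact: (integrableZr _ _ iS).
  rewrite -[leLHS]fineK ?lee_fin; last exact: integrable_fin_num.
  have -> : fine (\int[P]_w (EFin \o F k) w) = \int[P]_w F k w by [].
  under eq_Rintegral do rewrite FE.
  rewrite RintegralZr// ler_pdivrMr ?exprn_gt0 ?ltr0n ?expn_gt0//.
  apply: le_trans (var _) _; rewrite natrX.
  have k0 : k.+1%:R != 0 :> R by rewrite pnatr_eq0.
  by rewrite le_eqVlt; apply/orP; left; apply/eqP; field.
have sumF : (\int[P]_w \sum_(k <oo) (EFin \o F k) w < +oo)%E.
  rewrite integral_nneseries//.
  apply: (@le_lt_trans _ _ ((K * K) * 2)%:E); last by rewrite ltry.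
  apply: lime_le.
    by apply: is_cvg_nneseries => k _ _; apply: integral_ge0 => w _; exact: F0.
  apply: nearW => N.
  apply: le_trans (lee_sum _ (fun k _ => intF k)) _.
  rewrite sumEFin lee_fin -mulr_sumr.
  rewrite ler_wpM2l ?mulr_ge0 ?(ae_bounded_ge0 (ZK 1%N isT))//.
  by apply: le_trans (sum_inverse_squares_le _ _) _; rewrite gerBl invr_ge0.
have iSum : P.-integrable setT (fun w => \sum_(k <oo) (EFin \o F k) w)%E.
  apply/integrableP; split.
    apply: (@ge0_emeasurable_sum _ _ _ _ (fun k => EFin \o F k) xpredT)=> //.
  rewrite (eq_integral (fun w => \sum_(k <oo) (EFin \o F k) w)%E)// => w _.
  by rewrite gee0_abs// nneseries_ge0// => k _ _; exact: F0.
have /= := integrable_ae measurableT iSum.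
apply: filterS2 allK => w wK /(_ I) wfin.
apply: (cesaro_square_subsequence wK).
apply: (@cvg_series_cvg_0 _ R^o (fun k => F k w)).
apply: nnseries_is_cvg => [k|]; first exact: sqr_ge0.
by move: wfin; rewrite fin_numE -ltey => /andP[].
Qed.

End StrongLaw.

Section BoundedIid.
Context {d : measure_display} {T : measurableType d} {R : realType}
  (P : probability T R).

Lemma mutually_independent_pair (X : nat -> {RV P >-> R}) (s t : nat) (A B : set R) :
  mutually_independent X -> (0 < s)%N -> (0 < t)%N -> s != t ->
  measurable A -> measurable B ->
  P (X s @^-1` A `&` X t @^-1` B) = (P (X s @^-1` A) * P (X t @^-1` B))%E.
Proof.
move=> indX s0 t0 st mA mB.
have ts : (t == s) = false by rewrite eq_sym; exact/negbTE.
(* The two events are coded as one family of sets by testing [u == s], which [s != t] makes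
   faithful. *)
have := indX [:: s; t] (fun u => if u == s then A else B).
rewrite /= inE st !big_cons big_nil eqxx ts mule1 => <- //.
- congr (P _); apply/seteqP; split=> [w [wA wB] u /=|w H].
    by rewrite !inE => /orP[]/eqP ->; rewrite ?eqxx ?ts.
  split; first by have := H s; rewrite /= eqxx; apply; rewrite inE eqxx.
  by have := H t; rewrite /= ts; apply; rewrite !inE eqxx orbT.
- by move=> u; rewrite !inE => /orP[]/eqP ->.
- by move=> u _; case: ifP.
Qed.

Lemma identically_distributed_Rintegral (X : nat -> {RV P >-> R}) (K : R) t :
  identically_distributed X ->
  (forall s, (0 < s)%N -> {ae P, forall w, `|X s w| <= K}) -> (0 < t)%N ->
  \int[P]_w X t w = \int[P]_w X 1%N w.
Proof.
move=> idX XK t0.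
have Xi s : (0 < s)%N -> P.-integrable setT (EFin \o X s).
  by move=> s0; exact: integrable_ae_bounded (XK s s0).
congr fine; rewrite -[LHS](integral_distribution (f := EFin))//; last exact: Xi.
rewrite -[RHS](integral_distribution (f := EFin))//; last exact: Xi.
by apply: eq_measure_integral => A mA _; exact: idX.
Qed.

(** The centred variables are bounded by [K + |m|], and pairwise independence with a common mean
    makes them orthogonal. *)
Lemma strong_law_bounded (X : nat -> {RV P >-> R}) (K : R) :
  mutually_independent X -> identically_distributed X ->
  (forall t, (0 < t)%N -> {ae P, forall w, `|X t w| <= K}) ->
  {ae P, forall w, (fun t => (\sum_(1 <= s < t.+1) X s w) / t%:R) @ \oo -->
    (fine 'E_P[X 1%N] : R)}.
Proof.
move=> indX idX XK.
rewrite expectation_def -/(Rintegral P setT (X 1%N)).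
set m := \int[P]_w X 1%N w.
have Xi s : (0 < s)%N -> P.-integrable setT (EFin \o X s).
  by move=> s0; exact: integrable_ae_bounded (XK s s0).
have Em s : (0 < s)%N -> \int[P]_w X s w = m.
  by move=> s0; exact: identically_distributed_Rintegral XK s0.
have Zlaw : {ae P, forall w,
    (fun t => (\sum_(1 <= s < t.+1) (X s w - m)) / t%:R) @ \oo --> (0 : R)}.
  apply: (@orthogonal_strong_law _ _ _ P (fun s w => X s w - m) (K + `|m|)).
  - by move=> t; exact: measurable_funB.
  - move=> t t0; apply: (ae_boundedD (g := cst (- m)) (XK t t0)).
    by apply: aeW => w; rewrite /= normrN.
  move=> s t /andP[s0 st]; have t0 : (0 < t)%N by exact: leq_trans st.
  have XXi : P.-integrable setT (EFin \o (fun w => X s w * X t w)).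
    apply: (integrable_ae_bounded _ (ae_boundedM (XK s s0) (XK t t0))).
    exact: measurable_funM.
  have Xim u : (0 < u)%N -> P.-integrable setT (EFin \o (fun w => X u w * - m)).
    by move=> u0; exact: (integrableZr _ (- m) (Xi u u0)).
  have ci : P.-integrable setT (EFin \o (fun=> m * m)).
    by apply: (integrable_ae_bounded (K := `|m * m|)) => //; exact: aeW.
  have -> : \int[P]_w ((X s w - m) * (X t w - m)) = \int[P]_w
      (X s w * X t w + (X s w * - m + (X t w * - m + m * m))).
    by apply: eq_Rintegral => w _; ring.
  have i1 : P.-integrable setT (EFin \o (fun w => X t w * - m + m * m)).
    exact: (integrableD _ (Xim t t0) ci).
  have i2 : P.-integrable setT
      (EFin \o (fun w => X s w * - m + (X t w * - m + m * m))).
    exact: (integrableD _ (Xim s s0) i1).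
  rewrite RintegralD// RintegralD//; last exact: Xim.
  rewrite RintegralD//; last exact: Xim.
  rewrite (RintegralZr _ measurableT (Xi s s0)) (RintegralZr _ measurableT (Xi t t0)).
  rewrite Rintegral_cst// [fine _](_ : _ = fine (P setT))//.
  rewrite probability_setT mulr1 !Em//.
  rewrite (Rintegral_independentM (XK s s0) (XK t t0)) ?Em//; first ring.
  by move=> A B mA mB; apply: mutually_independent_pair; rewrite ?ltn_eqF.
apply: filterS Zlaw => w /cvgrPdist_lt Zlim.
apply/cvgrPdist_lt => e /Zlim [N _ HN]; exists N.+1 => // t /= Nt.
have t0 : t%:R != 0 :> R by rewrite pnatr_eq0 -lt0n (leq_trans _ Nt).
have := HN t (ltnW Nt); rewrite /= sub0r sumrB sumr_const_nat subSS subn0.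
rewrite mulrBl -[m *+ t]mulr_natr -mulrA divff// mulr1 opprB; exact.
Qed.

End BoundedIid.

(** * Conclusion *)

Section Measurability.
Context {d : measure_display} {T : measurableType d} {R : realType} {n : nat}
  (E : nat -> rel 'I_n).
Implicit Types (t : nat) (i : 'I_n).

(** The weights are deterministic, so dividing by them is multiplication by a constant when
    measurability of the ratio is checked. *)
Lemma vseq_indep (xs xs' : 'I_n -> nat -> R) t : vseq E xs t = vseq E xs' t.
Proof.
case: t => // t; elim: t => // t IH.
by rewrite (vseqS E xs)// (vseqS E xs')// IH.
Qed.

Lemma measurable_push t (a : T -> 'I_n -> R) i :
  (forall j, measurable_fun setT (a ^~ j)) ->
  measurable_fun setT (fun w => push E t (a w) i).
Proof.
move=> ma; under eq_fun do rewrite push_weightsE.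
by apply: measurable_sum => j; exact: measurable_funM.
Qed.

Lemma measurable_zavg (x : 'I_n -> nat -> T -> R) i t :
  (forall j s, measurable_fun setT (x j s)) ->
  measurable_fun setT (fun w => zavg (fun j s => x j s w) i t).
Proof.
by move=> mx; apply: measurable_funM => //; apply: measurable_sum.
Qed.

Lemma measurable_yseq (x : 'I_n -> nat -> T -> R) t i :
  (forall j s, measurable_fun setT (x j s)) ->
  measurable_fun setT (fun w => yseq E (fun j s => x j s w) t i).
Proof.
move=> mx; case: t => [|t]; first exact: mx.
elim: t i => [|t IH] i; first exact: mx.
under eq_fun do rewrite yseqS//.
apply: measurable_funB; last exact: measurable_zavg.
by apply: measurable_funD; [exact: measurable_push|exact: measurable_zavg].
Qed.

Lemma measurable_ps_ratio (x : 'I_n -> nat -> T -> R) t i :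
  (forall j s, measurable_fun setT (x j s)) ->
  measurable_fun setT (fun w => ps_ratio E (fun j s => x j s w) t i).
Proof.
move=> mx; apply: measurable_funM.
  by apply: measurable_push => j; exact: measurable_yseq.
apply: (eq_measurable_fun (cst (vseq E (fun _ _ => 0) t i)^-1)) => // w _.
by rewrite /= (vseq_indep _ (fun j s => x j s w)).
Qed.

End Measurability.

Unset Implicit Arguments.
Set Strict Implicit.

Theorem theorem2 (d : measure_display) (T : measurableType d) (R : realType)
  (P : probability T R) (n : nat) (E : nat -> rel 'I_n)
  (x : 'I_n -> nat -> {RV P >-> R}) (K : R) :
  (1 < n)%N ->
  (forall i, mutually_independent (x i)) ->
  (forall i, identically_distributed (x i)) ->
  (forall i t, (1 <= t)%N -> {ae P, forall w, `|x i t w| <= K}) ->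
  sym_stoch_compatible R E ->
  repeatedly_jointly_sc E ->
  let xbar := (n%:R)^-1 * \sum_(i < n) fine ('E_P[x i 1%N]) in
  {ae P, forall w, forall i : 'I_n,
      (fun t : nat => ps_ratio E (fun j s => x j s w) t i) @ \oo --> (xbar : R)}
  /\
  exists C : R,
    (fun t : nat => P [set w | forall i j : 'I_n,
        ps_ratio E (fun k s => x k s w) t i - ps_ratio E (fun k s => x k s w) t j
          <= C / t%:R]) @ \oo --> 1%E.
Proof.
move=> n1 indx idx xK _ rsc xbar; have n0 : (0 < n)%N by exact: ltnW.
have [C C0 HC] := push_sum_rate K n0 rsc.
have allK : {ae P, forall w, forall i s, (0 < s)%N -> `|x i s w| <= K}.
  apply: filter_forall => i; apply: ae_foralln => s.
  have [->|s0] := posnP s; first exact: aeW.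
  by apply: filterS (xK i s s0).
split.
  have zlaw : {ae P, forall w, forall i, zavg (fun j s => x j s w) i t @[t --> \oo] -->
      (fine 'E_P[x i 1%N] : R)}.
    by apply: filter_forall => i; exact: strong_law_bounded (xK i).
  apply: filterS2 allK zlaw => w wK wz i.
  have zbar : n%:R^-1 * (\sum_j zavg (fun j s => x j s w) j t) @[t --> \oo] --> xbar.
    apply: cvgM; first exact: cvg_cst.
    by apply: cvg_big => [|j _]; [exact: add_continuous|exact: wz].
  (* The ratio at [t.+1] is compared with the sample averages at [t], hence the shift. *)
  rewrite -cvg_shiftS; apply/cvgrPdist_lt => e e0; near=> t.
  have t0 : (0 < t)%N by near: t; exact: nbhs_infty_gt.
  have [_ rz] := HC _ wK t t0 i.
  have Ct : C / t%:R < e / 2.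
    rewrite ltr_pdivrMr ?ltr0n// mulrC -ltr_pdivrMr ?divr_gt0//.
    by near: t; exact: nbhs_infty_gtr.
  have zt : `|xbar - n%:R^-1 * (\sum_j zavg (fun j s => x j s w) j t)| < e / 2.
    near: t; move/cvgrPdist_lt: zbar; apply; exact: divr_gt0.
  rewrite [ltRHS]splitr; apply: le_lt_trans (ltrD zt (le_lt_trans rz Ct)).
  set z := n%:R^-1 * _; set p := ps_ratio _ _ _ _.
  by rewrite -[`|p - z|]distrC; apply: le_trans (ler_normD _ _); rewrite addrA subrK.
(* The spread at [t.+2] is at most [C / t.+1], and [t.+2 <= 2 * t.+1] explains [2 * C]. The event
   contains the almost sure event of bounded samples, so its probability is exactly [1] from time
   [2] on, where [mu] starts. *)
exists (2 * C); apply: cvg_near_cst; exists 2%N => // -[//|[//|t]] _ /=.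
set A := [set w | _].
have mA : measurable A.
  rewrite (_ : A = \bigcap_(i in [set: 'I_n]) \bigcap_(j in [set: 'I_n]) [set w |
      ps_ratio E (fun k s => x k s w) t.+2 i - ps_ratio E (fun k s => x k s w) t.+2 j
      <= 2 * C / t.+2%:R]); last first.
    by apply/seteqP; split=> [w wA i _ j _|w wA i j]; [exact: wA|exact: wA].
  apply: fin_bigcap_measurable => // i _; apply: fin_bigcap_measurable => // j _.
  have mr k : measurable_fun setT
      (fun w => ps_ratio E (fun k s => x k s w) t.+2 k).
    exact: (measurable_ps_ratio E).
  have := measurable_fun_ler (measurable_funB (mr i) (mr j))
    (measurable_cst (2 * C / t.+2%:R)).
  by move=> /(_ measurableT [set true]); rewrite setTI; exact.
have : P (~` A) = 0%E.
  apply: measure_negligible; first exact: measurableC.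
  apply: filterS allK => w wK i j.
  have [/(_ j) rij _] := HC _ wK t.+1 isT i.
  apply: le_trans rij _; rewrite mulrAC mulrC ler_wpM2r//.
  rewrite ler_pdivlMr// ler_pdivrMl// -natrM ler_nat; lia.
by rewrite probability_setC// => /eqP; rewrite sube_eq// add0e => /eqP.
Unshelve. all: by end_near.
Qed.
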